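(* A regular space $X$ is $R$-closed if and only if every infinite set $A\subseteq X$ $\theta(\omega)$-converges to the set $B$ of all its $\theta(\omega)$-accumulation points.
   Context: Regular spaces are assumed Hausdorff; all neighborhoods are open; $\mathrm{cl}\,M=\overline M$ is the closure in $X$. An $R$-closed space is a regular space that is closed in every regular space containing it as a subspace. A neighborhood $U$ of a point $x$ is an $\omega$-hull of $x$ if there is a sequence of neighborhoods $\{U_i\}_{i=1}^\infty$ of $x$ with $\mathrm{cl}\,U_i\subseteq U_{i+1}$ and $U_i\subseteq U$ for every $i$. A point $x\in X$ is a $\theta(\omega)$-accumulation point of an infinite set $F$ if $|F\cap U|=|F|$ for every $\omega$-hull $U$ of $x$. For a set $B\subseteq X$, an open cover of $B$ is a family of open subsets of $X$ whose union contains $B$. An open cover $\mathcal V$ is a shrinkable refinement of an open cover $\mathcal U$ if for each $V\in\mathcal V$ there is $U\in\mathcal U$ with $\overline V\subseteq U$. An open cover $\mathcal V$ is a regular refinement of $\mathcal U$ if $\mathcal V$ refines $\mathcal U$ and $\mathcal V$ is a shrinkable refinement of itself. An open cover of $B$ is regular if it has a regular refinement that is an open cover of $B$. A set $A$ $\theta(\omega)$-converges to a set $B$ if for every regular cover $\gamma$ of $B$ there is a finite family $\{U_{\alpha_i}\}_{i=1}^s\subseteq\gamma$ such that $|A\setminus\bigcup_{i=1}^s U_{\alpha_i}|<|A|$. *)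

(* Defs.v *)
From HB Require Import structures.
From mathcomp Require Import all_boot all_order all_algebra.
From mathcomp Require Import all_classical all_reals all_analysis.

Set Implicit Arguments.
Unset Strict Implicit.
Unset Printing Implicit Defensive.

Local Open Scope classical_set_scope.
Local Open Scope card_scope.

(* The library's [regular_space] does not include any separation of points. *)
Definition regular_hausdorff (X : topologicalType) : Prop :=
  regular_space X /\ hausdorff_space X.

(* [X], via [f], is a subspace of [Y]. *)
Definition embedding (X Y : topologicalType) (f : X -> Y) : Prop :=
  injective f /\ @open X = @open (initial_topology f).

Definition R_closed (X : topologicalType) : Prop :=
  regular_hausdorff X /\
  forall (Y : topologicalType) (f : X -> Y),
    regular_hausdorff Y -> embedding f -> closed (range f).

Definition card_lt (T U : Type) (A : set T) (B : set U) : Prop :=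
  A #<= B /\ ~ (B #<= A).

Section ThetaOmega.
Context {X : topologicalType}.
Implicit Types (x : X) (A B U : set X) (UU VV : set (set X)).

Definition omega_hull x U : Prop :=
  open_nbhs x U /\
  exists W : nat -> set X,
    forall i, [/\ open_nbhs x (W i), closure (W i) `<=` W i.+1 & W i `<=` U].

Definition theta_omega_accumulation A x : Prop :=
  forall U, omega_hull x U -> A `&` U #= A.

Definition open_cover B UU : Prop :=
  (forall U, UU U -> open U) /\ B `<=` \bigcup_(U in UU) U.

Definition refines VV UU : Prop :=
  forall V, VV V -> exists2 U, UU U & V `<=` U.

Definition shrinkable_refinement VV UU : Prop :=
  forall V, VV V -> exists2 U, UU U & closure V `<=` U.

Definition regular_refinement VV UU : Prop :=
  refines VV UU /\ shrinkable_refinement VV VV.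

Definition regular_cover B UU : Prop :=
  open_cover B UU /\ exists VV, open_cover B VV /\ regular_refinement VV UU.

Definition theta_omega_converges A B : Prop :=
  forall UU, regular_cover B UU ->
    exists FF : set (set X), [/\ finite_set FF, FF `<=` UU &
      card_lt (A `\` \bigcup_(U in FF) U) A].

End ThetaOmega.

(* Main.v *)
Require Import Defs.
From HB Require Import structures.
From mathcomp Require Import all_boot all_order all_algebra.
From mathcomp Require Import all_classical all_reals all_analysis.
From mathcomp Require Import wochoice.

(* Both conditions are compared with a covering property: every open cover of
   [X] that is a shrinkable refinement of itself has a finite subcover.  The
   complements of the members of such a cover form a regular filter base, so a
   cover without finite subcover yields a regular one-point extension of [X] in
   which [X] is not closed, and conversely.

   If the covering property holds, a regular cover of the accumulation points
   of [A] is completed to a cover of [X] by the chains of neighborhoods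
   witnessing that the other points are not accumulation points; a member of
   such a chain meets [A] in fewer than [#|A|] points, so finitely many of them
   can be ignored.

   If it fails, take a cover [SS] without finite subcover, closed under a fixed
   shrinking map and well-ordered with least possible order type, and choose a
   set [A] with one point for each value of the map sending [x] to the least
   member of [SS] containing [x].  Then every member of [SS] meets [A] in fewer
   than [#|A|] points, so [A] does not even converge to [X]. *)

Set Implicit Arguments.
Unset Strict Implicit.
Unset Printing Implicit Defensive.

Local Open Scope classical_set_scope.
Local Open Scope card_scope.

(** * Cardinal arithmetic of infinite sets *)

Lemma card_le_set_inj T U (A : set T) (B : set U) (f : T -> U) :
  set_fun A B f -> set_inj A f -> A #<= B.
Proof.
move=> fAB fI; have [g] : $|{injfun A >-> B}| by apply/injfunPex; exists f.
exact: inj_card_le.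
Qed.

Lemma card_le_fun T U (A : set T) (B : set U) :
  B !=set0 -> A #<= B -> exists2 f : T -> U, set_fun A B f & set_inj A f.
Proof.
elim/Ppointed: U B => U B [b _] AB; first by have := no b.
by have /pcard_leP/injfunPex := AB.
Qed.

(** Zorn's lemma on graphs of partial injections from [A] to [B]: a maximal one is defined on all of
    [A] or reaches all of [B], since otherwise a pair could be added. *)
Lemma card_le_total T U (A : set T) (B : set U) : A #<= B \/ B #<= A.
Proof.
pose P (G : set (T * U)) := [/\ G `<=` A `*` B,
  forall a b b', G (a, b) -> G (a, b') -> b = b' &
  forall a a' b, G (a, b) -> G (a', b) -> a = a'].
have [|G [[GAB Gf Gi] Gmax]] := @Zorn_bigcup _ P.
  move=> F FP Ftot.
  have two z z' : (\bigcup_(G in F) G) z -> (\bigcup_(G in F) G) z' ->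
      exists G, [/\ F G, G z & G z'].
    move=> [G FG Gz] [H FH Hz']; have [GH|HG] := Ftot _ _ FG FH.
      by exists H; split=> //; exact: GH.
    by exists G; split=> //; exact: HG.
  split.
  - by move=> z [G /FP [GAB _ _] /GAB].
  - by move=> a b b' /two h /h [G [/FP [_ Gf _] ]]; exact: Gf.
  - by move=> a a' b /two h /h [G [/FP [_ _ Gi] ]]; exact: Gi.
have [dom|/existsNP [a /not_implyP [Aa aG]]] :=
    pselect (forall a, A a -> exists b, G (a, b)).
  left; have [A0|/set0P [a0 Aa0]] := eqVneq A set0.
    by rewrite A0; exact: card_ge0.
  have [b0 _] := dom _ Aa0.
  have /choice [f fP] : forall a, exists b, A a -> G (a, b).
    by move=> a; have [/dom [b]|] := pselect (A a); [exists b|exists b0].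
  apply: (@card_le_set_inj _ _ _ _ f) => [a /fP /GAB []//|a a'].
  by rewrite !inE => /fP Ga /fP Ga' e; rewrite e in Ga; exact: Gi Ga Ga'.
have [cod|/existsNP [b /not_implyP [Bb bG]]] :=
    pselect (forall b, B b -> exists a, G (a, b)).
  have /choice [f fP] : forall b, exists a, B b -> G (a, b).
    by move=> b; have [/cod [a']|] := pselect (B b); [exists a'|exists a].
  right; apply: (@card_le_set_inj _ _ _ _ f) => [b /fP /GAB []//|b b'].
  by rewrite !inE => /fP Gb /fP Gb' e; rewrite e in Gb; exact: Gf Gb Gb'.
exfalso; apply: (Gmax (G `|` [set (a, b)])).
  rewrite properEneq; split; last exact: subsetUl.
  apply/eqP => e; apply: aG; exists b; rewrite e; by right.
split.
- by move=> z [/GAB//|->].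
- move=> x y y' [Gy|[xa yb]] [Gy'|[xa' yb']].
  + exact: Gf Gy Gy'.
  + by case: aG; exists y; rewrite -xa'.
  + by case: aG; exists y'; rewrite -xa.
  + by rewrite yb yb'.
- move=> x x' y [Gx|[xa yb]] [Gx'|[xa' yb']].
  + exact: Gi Gx Gx'.
  + by case: bG; exists x; rewrite -yb'.
  + by case: bG; exists x'; rewrite -yb.
  + by rewrite xa xa'.
Qed.

(* A maximal disjoint family of countably infinite subsets leaves out only
   finitely many points of [A], so [A] is split into blocks each of which
   absorbs a factor [nat]. *)
Lemma infinite_card_setX_nat T (A : set T) :
  infinite_set A -> A `*` [set: nat] #<= A.
Proof.
move=> infA.
pose D := [set C : set T | C `<=` A /\ C #= [set: nat]].
have [E [ED Etriv Emax]] := ex_maximal_disjoint_subcollection id D.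
pose L := A `\` \bigcup_(C in E) C.
have finL : finite_set L.
  apply: contrapT => /infiniteP nL.
  have L0 : L !=set0.
    by apply/infinite_setN0/infiniteP.
  have [e eL eI] := card_le_fun L0 nL.
  have eE : ~ E (range e).
    by move=> Ee; have [_] := eL 0%N I; apply; exists (range e) => //; exists 0%N.
  apply: (Emax (E `|` [set range e])).
  - rewrite properEneq; split; last exact: subsetUl.
    by apply/eqP => h; apply: eE; rewrite h; right.
  - move=> C [/ED//|->]; split; first by move=> _ [n _ <-]; have [] := eL n I.
    exact: inj_card_eq.
  - move=> C C' [EC|->] [EC'|->]//; first exact: Etriv.
      by move=> [x [Cx [n _ xe]]]; have [_ []] := eL n I; exists C; rewrite ?xe.
    by move=> [_ [[n _ <-]] Cx]; have [_ []] := eL n I; exists C'.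
have [C0 EC0] : E !=set0.
  apply/set0P/eqP => E0; apply: infA; apply: sub_finite_set finL => x Ax.
  by split=> //; rewrite E0 => -[].
(* The finitely many leftover points join the block [C0], which stays countable. *)
have /choice [c cP] : forall x, exists C, E C /\ (A x -> C x \/ L x /\ C = C0).
  move=> x; have [[C EC Cx]|nx] := pselect ((\bigcup_(C in E) C) x).
    by exists C; split=> // _; left.
  by exists C0; split=> // Ax; right.
have /choice [h hI] : forall C, exists h : T -> nat,
    E C -> {in [set x | A x /\ c x = C] &, injective h}.
  move=> C; have [EC|] := pselect (E C); last by exists (fun=> 0%N).
  suff /countable_injP [h] : countable [set x | A x /\ c x = C] by exists h.
  apply: (@sub_countable _ _ _ (C `|` L)).
    apply: subset_card_le => x [Ax <-]; have [_ /(_ Ax) [?|[? _]]] := cP x;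
    by [left|right].
  have -> : C `|` L = \bigcup_b (if b then C else L).
    apply/seteqP; split=> [x [Cx|Lx]|x [[] _]];
      by [exists true|exists false|left|right].
  apply: bigcup_countable; first exact: countableP.
  move=> [] _; last exact: finite_set_countable.
  by have [_] := ED _ EC; rewrite card_eq_le => /andP[].
have /choice [e eP] : forall C, exists e : nat -> T,
    E C -> set_fun setT C e /\ set_inj setT e.
  move=> C; have [EC|] := pselect (E C); last first.
    have [x _] := infinite_setN0 infA; by exists (fun=> x).
  have [CA] := ED _ EC; rewrite card_eq_le => /andP[_ nC].
  have [|e] := card_le_fun _ nC; last by exists e.
  exact/infinite_setN0/infiniteP.
(* The index of [x] in its block and [n] are coded as one number, which [e (c x)] sends back into
   that block. *)
pose k (x : T) (n : nat) : nat := pickle (h (c x) x, n).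
apply: (@card_le_set_inj _ _ _ _ (fun z => e (c z.1) (k z.1 z.2))).
  move=> [x n] [/= Ax _]; have [Ec _] := cP x.
  by have [CA _] := ED _ Ec; apply/CA/(eP _ Ec).1.
move=> [x n] [y m]; rewrite !inE /= => -[/= Ax _] [/= Ay _] exy.
have [[Ex _] [Ey _]] := (cP x, cP y).
have cxy : c x = c y.
  apply: Etriv => //; exists (e (c x) (k x n)); split; first exact: (eP _ Ex).1.
  by rewrite exy; exact: (eP _ Ey).1.
move: exy; rewrite /k cxy => /((eP _ Ey).2 _ _ (in_setT _) (in_setT _)).
move=> /(pcan_inj pickleK) [/(hI _ Ey) xy ->]; rewrite xy//; apply/mem_set; split=> //.
Qed.

(** The larger set, say [C], absorbs the other: the union embeds in two copies of [C], inside the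
    product of [C] with [nat]. *)
Lemma card_le_setU_infinite T U (A : set U) (C D : set T) :
  infinite_set A -> A #<= C `|` D -> A #<= C \/ A #<= D.
Proof.
wlog DC : C D / D #<= C.
  move=> h infA ACD; have [CD|DC] := card_le_total C D; last exact: h.
  by apply/or_comm/h => //; rewrite setUC.
move=> infA ACD; left.
have infCD : infinite_set (C `|` D).
  by move=> fCD; apply: infA; exact: card_le_finite ACD fCD.
have infC : infinite_set C.
  move=> fC; apply: infCD; rewrite finite_setU; split=> //.
  exact: card_le_finite DC fC.
have [f fDC fI] := card_le_fun (infinite_setN0 infC) DC.
apply: (card_le_trans ACD); apply: (card_le_trans _ (infinite_card_setX_nat infC)).
apply: (@card_le_set_inj _ _ _ _
  (fun x => if pselect (C x) then (x, 0%N) else (f x, 1%N))).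
  by move=> x [Cx|Dx]; case: pselect => //= nCx; split=> //; exact: fDC.
move=> x y; rewrite !inE => xCD yCD.
case: pselect => Cx; case: pselect => Cy // -[]//.
by case: xCD yCD => // Dx [//|Dy] /fI; apply; apply: mem_set.
Qed.

Lemma card_le_bigcup_finite (I : choiceType) T U (A : set U) (J : set I)
    (F : I -> set T) : infinite_set A -> finite_set J ->
  A #<= \bigcup_(i in J) F i -> exists2 i, J i & A #<= F i.
Proof.
move=> infA /finite_seqP [s ->]; elim: s => [|i s ih] AF.
  move: AF; rewrite set_nil bigcup_set0 => AF; case: infA.
  exact: card_le_finite AF (finite_set0 _).
move: AF; rewrite bigcup_seq big_cons -bigcup_seq.
move=> /(card_le_setU_infinite infA) [Ai|/ih [j js Aj]].
  by exists i => //=; rewrite mem_head.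
by exists j => //=; rewrite in_cons js orbT.
Qed.

(** * Well-orderings *)

Lemma ex_well_order (T : eqType) : exists lt : T -> T -> Prop,
  (forall x y, x <> y -> lt x y \/ lt y x) /\
  (forall D : set T, D !=set0 -> exists2 d, D d & forall e, D e -> ~ lt e d).
Proof.
have [R Rwo] := well_ordering_principle T.
have Ranti x y : R x y -> R y x -> x = y.
  move=> xy yx; apply: (@wo_chain_antisymmetric T R predT) => //.
    by move=> B _; exact: Rwo.
  by rewrite xy yx.
(* With the negated converse as strict order, totality is antisymmetry of [R]. *)
exists (fun x y => ~~ R y x); split=> [x y xy|D [x Dx]].
  by apply/orP; rewrite -negb_and; apply/negP => /andP[yx /Ranti /(_ yx)].
have [|d [[Dd dmin] _]] := Rwo [pred x | `[<D x>] ].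
  by exists x; exact/asboolP.
exists d; first exact/asboolP.
by move=> e De; apply/negP; rewrite negbK; apply: dmin; apply/asboolP.
Qed.

(* Well-ordering a member of [P] of least order type makes its proper initial
   segments too small to dominate any member of [P]. *)
Lemma ex_minimal_well_order (T : pointedType) (P : set (set T)) : P !=set0 ->
  exists (S : set T) (lt : T -> T -> Prop), [/\ P S,
    forall D, D `<=` S -> D !=set0 ->
      exists2 d, D d & forall e, D e -> e = d \/ lt d e &
    forall t S', S t -> P S' -> ~ (S' #<= [set u | S u /\ lt u t])].
Proof.
move=> [S0 PS0]; have [lt [tot wf]] := ex_well_order T.
pose small t := exists2 S, P S & S #<= [set u | lt u t].
have [t0|no_small] := pselect (small !=set0); last first.
  exists S0, lt; split=> //.
    move=> D _ /wf [d Dd dmin]; exists d => // e De.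
    by have [->|/eqP/tot [/(dmin e De)|]] := eqVneq e d; [left| |right].
  move=> t S' _ PS' S't; apply: no_small; exists t; exists S' => //.
  by apply: (card_le_trans S't); apply: subset_card_le => u [].
(* For the least small [t], the order is pulled back along an injection of [S] into the segment
   below [t]; a failure at [u] would make [f u] a smaller small element. *)
have [t [S PS St] tmin] := wf _ t0.
have [f fS fI] : exists2 f : T -> T,
    set_fun S [set u | lt u t] f & set_inj S f by exact/injfunPex/pcard_leP.
exists S, (fun u v => lt (f u) (f v)); split=> //.
  move=> D DS [x Dx]; have [|_ [d Dd <-] dmin] := wf (f @` D).
    by exists (f x); exists x.
  exists d => // e De; have [->|ed] := eqVneq e d; [by left|right].
  have [/eqP|fed|//] := tot (f e) (f d).
    by apply/negP; apply: contraNneq ed => /fI ->//; apply/mem_set; exact: DS.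
  by have := dmin (f e) (imageP f De).
move=> u S' Su PS' S'u; apply: (tmin (f u)); last exact: fS.
exists S' => //; apply: (card_le_trans S'u).
apply: (@card_le_set_inj _ _ _ _ f) => [v []//|].
by apply: sub_in2 fI => v; rewrite !inE => -[].
Qed.

(** * Regular one-point extensions *)

Lemma regular_closed1_hausdorff (T : topologicalType) : regular_space T ->
  (forall x : T, closed [set x]) -> hausdorff_space T.
Proof.
move=> regT T1 p q; apply: contraPP => pq.
have /regT [M pM Mq] : nbhs p (~` [set q]).
  by apply: open_nbhs_nbhs; split; [exact: closed_openC|].
move=> pq'; apply: (Mq q) => // B qB; exact: pq'.
Qed.

Lemma preimage_Some_image (X : Type) (A : set X) : Some @^-1` (Some @` A) = A.
Proof. by apply/seteqP; split=> [x [y Ay [<-]]|x Ax]//; exists x. Qed.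

(* [UU] only serves as a phantom parameter selecting the topology: it makes the
   extra point [None] a limit of the complements of the members of [UU]. *)
Definition one_point_extension (X : Type) (UU : set (set X)) : Type := option X.

Section one_point_extension.
Context (X : topologicalType) (UU : set (set X)).
Local Notation Y := (one_point_extension UU).

Definition ext_open (W : set Y) : Prop :=
  open (Some @^-1` W) /\ (W None -> exists FF, [/\ finite_set FF, FF `<=` UU &
    ~` (\bigcup_(U in FF) U) `<=` Some @^-1` W]).

Let ext_openT : ext_open setT.
Proof.
split; first exact: openT.
by move=> _; exists set0; split=> //; exact: sub0set.
Qed.

Let ext_openI : setI_closed ext_open.
Proof.
move=> V W [oV VN] [oW WN]; split; first exact: openI.
move=> [/VN [FF [finF FU FV]] /WN [GG [finG GU GW]]]; exists (FF `|` GG); split.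
- by rewrite finite_setU.
- by rewrite subUset.
- move=> x xFG; split.
    by apply: FV => -[U FFU Ux]; apply: xFG; exists U => //; left.
  by apply: GW => -[U GGU Ux]; apply: xFG; exists U => //; right.
Qed.

Let ext_open_bigU (I : Type) (f : I -> set Y) :
  (forall i, ext_open (f i)) -> ext_open (\bigcup_i f i).
Proof.
move=> fo; split.
  by rewrite preimage_bigcup; apply: bigcup_open => i _; exact: (fo i).1.
move=> [i _ /(fo i).2 [FF [finF FU Ff]]]; exists FF; split=> //.
by move=> x /Ff; exists i.
Qed.

HB.instance Definition _ := Choice.on Y.
HB.instance Definition _ :=
  isOpenTopological.Build Y ext_openT ext_openI ext_open_bigU.

Lemma ext_openE : @open Y = ext_open.
Proof. by []. Qed.

Lemma ext_embedding : embedding (Some : X -> Y).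
Proof.
split; first by move=> x y [].
apply/seteqP; split=> [U oU|_ [W [oW _] <-]//].
exists (Some @` U); last exact: preimage_Some_image.
rewrite ext_openE; split; last by move=> [].
by rewrite preimage_Some_image.
Qed.

Lemma ext_regular_hausdorff : regular_hausdorff X -> open_cover setT UU ->
  shrinkable_refinement UU UU -> regular_hausdorff Y.
Proof.
move=> [regX hX] [UUo UUc] UUs.
have T1 (y : Y) : closed [set y].
  rewrite -openC ext_openE; case: y => [x|]; split.
  - have -> : (Some : X -> Y) @^-1` (~` [set Some x]) = ~` [set x].
      by apply/seteqP; split=> z /= h e; apply: h; [rewrite e|case: e].
    rewrite openC; exact/accessible_closed_set1/hausdorff_accessible.
  - have [U UUU Ux] := UUc x I.
    move=> _; exists [set U]; split=> //; first by move=> _ ->.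
    by rewrite bigcup_set1 => z Uz [zx]; apply: Uz; rewrite zx.
  - have -> : (Some : X -> Y) @^-1` (~` [set None]) = setT by apply/seteqP.
    exact: openT.
  - by move=> /(_ erefl).
have sub_range (A : set X) (x : X) :
    @closure Y (Some @` A) (Some x) -> closure A x.
  move=> clA B; rewrite nbhsE => -[V [oV Vx] VB].
  have : @nbhs _ Y (Some x) (Some @` V).
    apply: open_nbhs_nbhs; split; last by exists x.
    rewrite ext_openE; split; last by move=> [].
    by rewrite preimage_Some_image.
  move=> /clA [_ [[a Aa <-] [b Vb [ba]]]]; exists a; split=> //.
  by apply: VB; rewrite -ba.
suff regY : regular_space Y by split=> //; exact: regular_closed1_hausdorff.
move=> y N yN; have [W [oW +] WN] : exists2 W, open_nbhs y W & W `<=` N.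
  by rewrite nbhsE in yN.
case: y {yN} => [x|] Wx.
  (* Working inside a member [U] keeps [None] out of the closure: the complement of [closure U] is a
     trace of a neighborhood of [None], as [U'] contains [closure U]. *)
  have [U UUU Ux] := UUc x I; have [U' UU' UU'sub] := UUs _ UUU.
  have /regX [V xV clV] : nbhs x (U `&` Some @^-1` W).
    apply: open_nbhs_nbhs; split=> //.
    by apply: openI; [exact: UUo|exact: oW.1].
  exists (Some @` (V° )).
    apply: (@open_nbhs_nbhs Y); split; last by exists x.
    rewrite ext_openE; split; last by move=> [].
    by rewrite preimage_Some_image; exact: open_interior.
  move=> [y /sub_range|clN].
    by move=> /(closureS (@interior_subset _ V)) /clV [_ /WN].
  exfalso; have : @nbhs _ Y None ([set None] `|` Some @` (~` closure U)).
    apply: (@open_nbhs_nbhs Y); split; last by left.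
    rewrite ext_openE; split.
      have -> : (Some : X -> Y) @^-1` ([set None] `|` Some @` (~` closure U)) =
          ~` closure U.
        by apply/seteqP; split=> [z [//|[a ? [<-]]]//|z Uz]; right; exists z.
      by rewrite openC; exact: closed_closure.
    move=> _; exists [set U']; split=> //; first by move=> _ ->.
    by rewrite bigcup_set1 => z Uz; right; exists z => // /UU'sub.
  move=> /clN [_ [[a Va <-] [//|[b bU [ba]]]]]; apply: bU; rewrite ba.
  by apply: subset_closure; have [] := clV a (subset_closure (interior_subset Va)).
have [FF [finF FU FW]] := oW.2 Wx.
have /choice [s sP] : forall U, exists V, UU U -> UU V /\ closure U `<=` V.
  move=> U; have [/UUs [V ? ?]|] := pselect (UU U); last by exists setT.
  by exists V.
(* Removing the closures still leaves a neighborhood of [None], because [closure U] lies in [s U];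
   its closure misses each open [U] in [FF]. *)
pose C := \bigcup_(U in FF) closure U.
exists ([set None] `|` Some @` (~` C)).
  apply: (@open_nbhs_nbhs Y); split; last by left.
  rewrite ext_openE; split.
    have -> : (Some : X -> Y) @^-1` ([set None] `|` Some @` (~` C)) = ~` C.
      by apply/seteqP; split=> [z [//|[a ? [<-]]]//|z Cz]; right; exists z.
    by rewrite openC; apply: closed_bigcup => // U _; exact: closed_closure.
  move=> _; exists (s @` FF); split; first exact: finite_image.
    by move=> _ [U /FU /sP [? _] <-].
  move=> z sz; right; exists z => // -[U FFU Uz]; apply: sz; exists (s U).
    by exists U.
  exact: (sP _ (FU _ FFU)).2.
move=> [y|_]; last exact: WN.
move=> cly; apply/WN/FW => -[U FFU Uy].
have : @nbhs _ Y (Some y) (Some @` U).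
  apply: (@open_nbhs_nbhs Y); split; last by exists y.
  rewrite ext_openE; split; last by move=> [].
  by rewrite preimage_Some_image; exact/UUo/FU.
move=> /cly [_ [[->|[a aC <-]] [b Ub]//]] [ba]; apply: aC.
by exists U => //; rewrite -ba; exact: subset_closure.
Qed.

End one_point_extension.

(** * R-closedness as a covering property *)

Definition finitely_covering (X : Type) (UU : set (set X)) : Prop :=
  exists FF, [/\ finite_set FF, FF `<=` UU & setT `<=` \bigcup_(U in FF) U].

(** [X] is closed in its extension exactly when [None] is isolated, which yields a finite subcover.
    Conversely, a point [p] outside a closed-failing image gives a cover by traces of exteriors of
    neighborhoods of [p], and regularity at [p] makes it shrinkable. *)
Lemma R_closed_finitely_covering (X : topologicalType) : regular_hausdorff X ->
  R_closed X <-> forall UU : set (set X), open_cover setT UU ->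
    shrinkable_refinement UU UU -> finitely_covering UU.
Proof.
move=> regX; split=> [[_ RX] UU UUc UUs|fcX].
  have := RX _ _ (ext_regular_hausdorff regX UUc UUs) (ext_embedding UU).
  rewrite -openC ext_openE => -[_] [|FF [finF FU Fcov]]; first by move=> [].
  exists FF; split=> // x _; apply: contrapT => /Fcov; apply; by exists x.
split=> // Y f [regY hY] [fI fo] p clp; apply: contrapT => fp.
pose UU := [set f @^-1` (~` closure N) | N in nbhs p].
have fopen V : open V -> open (f @^-1` V).
  by move=> oV; rewrite fo; exists V.
have [||FF [finF FU Fcov]] := fcX UU.
- split.
    move=> _ [N _ <-]; apply: fopen; rewrite openC; exact: closed_closure.
  move=> x _; have /regY [N pN Nfx] : nbhs p (~` [set f x]).
    apply: open_nbhs_nbhs; split; last by move=> px; apply: fp; exists x.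
    rewrite openC; exact/accessible_closed_set1/hausdorff_accessible.
  exists (f @^-1` (~` closure N)); first by exists N.
  by rewrite /preimage /= => /Nfx; exact.
- move=> _ [N pN <-]; have [M pM MN] := regY p _ (nbhs_interior pN).
  exists (f @^-1` (~` closure M)); first by exists M.
  move=> x clx /MN Nx; have [|y [/= + /interior_subset Ny]] := clx (f @^-1` N° ).
    by apply: open_nbhs_nbhs; split=> //; apply: fopen; exact: open_interior.
  by apply; exact: subset_closure.
have /choice [n nP] : forall U, exists N,
    FF U -> nbhs p N /\ U = f @^-1` (~` closure N).
  move=> U; have [/FU [N pN <-]|] := pselect (FF U); last by exists setT.
  by exists N.
(* This neighborhood meets the image of [f] in a point that no member of [FF] covers. *)
have : nbhs p (\bigcap_(U in FF) n U).
  rewrite -(fset_setK finF); apply: filter_bigI => U.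
  by rewrite in_fset_set// => /set_mem /nP [].
move=> /clp [_ [[x _ <-] nx]].
have [U FFU Ux] := Fcov x I; have [_ UE] := nP _ FFU.
by move: Ux; rewrite {1}UE; apply; apply/subset_closure/nx.
Qed.

(** * The covering property and convergence *)

Lemma R_closed_theta_omega_converges (X : topologicalType) (A : set X) :
  R_closed X -> infinite_set A ->
  theta_omega_converges A [set x | theta_omega_accumulation A x].
Proof.
move=> RX infA UU [_ [VV [[VVo VVc] [VU VVs]]]].
have regX := RX.1.
(* The bound is imposed on every term of the chain, so that dropping the first term again gives a
   member of [hulls]. *)
pose hulls := [set H : set X | exists W : nat -> set X, [/\ W 0%N = H,
  forall i, open (W i) /\ closure (W i) `<=` W i.+1 &
  forall i, ~ (A #<= A `&` W i)]].
have [||FF [finF FVH Fcov]] :=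
    (R_closed_finitely_covering regX).1 RX (VV `|` hulls).
- split; first by move=> H [/VVo//|[W [<- Wo _]]]; exact: (Wo 0%N).1.
  move=> x _; have [/VVc [V VVV Vx]|] := pselect (theta_omega_accumulation A x).
    by exists V => //; left.
  move=> /existsNP [U /not_implyP [[_ [W WP]] AU]].
  exists (W 0%N); last by have [[]] := WP 0%N.
  right; exists W; split=> // [i|i AW]; first by have [[]] := WP i.
  apply: AU; rewrite card_eq_le; apply/andP; split.
    by apply: subset_card_le; exact: subIsetl.
  apply: (card_le_trans AW); apply: subset_card_le; apply: setIS.
  by have [] := WP i.
- move=> H [/VVs [V VVV HV]|[W [<- Wo WA]]]; first by exists V => //; left.
  exists (W 1%N); last exact: (Wo 0%N).2.
  by right; exists (fun i => W i.+1); split=> // i; exact: Wo.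
have /choice [r rP] : forall V, exists U, VV V -> UU U /\ V `<=` U.
  move=> V; have [/VU [U UUU VsU]|] := pselect (VV V); last by exists setT.
  by exists U.
exists (r @` (FF `&` VV)); split.
- exact/finite_image/finite_setIl.
- by move=> _ [V [_ /rP [? _]] <-].
set L := _ `\` _; split; first by apply: subset_card_le => x [].
move=> AL; have infL : infinite_set L.
  by move=> fL; apply: infA; exact: card_le_finite AL fL.
have LF : L #<= \bigcup_(H in FF) (L `&` H).
  apply: subset_card_le => x Lx; have [H FFH Hx] := Fcov x I.
  by exists H.
have [H FFH LH] := card_le_bigcup_finite infL finF LF.
have [VVH|[W [WH _ WA]]] := FVH _ FFH.
  apply/infL/(card_le_finite LH)/(sub_finite_set _ (finite_set0 X)).
  move=> x [[_ nx] Hx]; apply: nx.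
  by exists (r H); [exists H|exact: (rP _ VVH).2].
apply: (WA 0%N); rewrite WH; apply: (card_le_trans AL); apply: (card_le_trans LH).
by apply: subset_card_le => x [[]].
Qed.

Lemma theta_omega_converges_finitely_covering (X : topologicalType)
    (UU : set (set X)) :
  (forall A : set X, infinite_set A ->
     theta_omega_converges A [set x | theta_omega_accumulation A x]) ->
  open_cover setT UU -> shrinkable_refinement UU UU -> finitely_covering UU.
Proof.
move=> conv [UUo UUc] UUs; apply: contrapT => nfc.
have [x0 _] : @setT X !=set0.
  apply/set0P/eqP => X0; apply: nfc; exists set0; split=> //.
  by rewrite X0 => x [].
have /choice [s sP] : forall U, exists V, UU U -> UU V /\ closure U `<=` V.
  move=> U; have [/UUs [V ? ?]|] := pselect (UU U); last by exists setT.
  by exists V.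
(* Closure under [s] makes any such subcover a shrinkable refinement of itself. *)
pose P (SS : set (set X)) := [/\ SS `<=` UU, setT `<=` \bigcup_(U in SS) U &
  forall U, SS U -> SS (s U)].
have [|SS [lt [[SU Sc Ss] Smin ltS]]] := @ex_minimal_well_order (set X) P.
  by exists UU; split=> // U /sP [].
have /choice [g gP] : forall x, exists U, [/\ SS U, U x &
    forall V, SS V -> V x -> V = U \/ lt U V].
  move=> x; have [||U [SSU Ux] Umin] := Smin [set U | SS U /\ U x].
  - by move=> U [].
  - by have [U SSU Ux] := Sc x I; exists U.
  - by exists U; split=> // V SSV Vx; apply: Umin.
have infG : infinite_set (range g).
  move=> finG; apply: nfc; exists (range g); split=> //.
    by move=> _ [x _ <-]; have [/SU] := gP x.
  by move=> x _; exists (g x) => //; have [] := gP x.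
have /choice [a aP] : forall U, exists x, range g U -> g x = U.
  move=> U; have [[x _ <-]|] := pselect (range g U); [by exists x|by exists x0].
(* On these representatives [g] is injective, so [A] is as large as [range g]. *)
pose A := [set a U | U in range g].
have gA : g @` A = range g.
  apply/seteqP; split=> [_ [x _ <-]//|U gU].
  by exists (a U); [exists U|exact: aP].
have gI : {in A &, injective g}.
  move=> _ _ /set_mem[U gU <-] /set_mem[V gV <-].
  by rewrite !aP// => ->.
have GA : range g #<= A by rewrite -gA; exact: card_image_le.
have infA : infinite_set A.
  by move=> fA; apply: infG; exact: card_le_finite GA fA.
have [|FF [finF FS [_ AF]]] := conv A infA SS.
  split; first by split=> [U /SU /UUo//|x _]; exact: Sc.
  exists SS; split; first by split=> [U /SU /UUo//|x _]; exact: Sc.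
  split=> U SSU; first by exists U.
  by exists (s U); [exact: Ss|exact: (sP _ (SU _ SSU)).2].
have : A #<= (A `\` \bigcup_(U in FF) U) `|` \bigcup_(U in FF) (A `&` U).
  apply: subset_card_le => x Ax.
  have [[U FFU Ux]|nx] := pselect ((\bigcup_(U in FF) U) x); last by left.
  by right; exists U.
move=> /(card_le_setU_infinite infA) [//|].
move=> /(card_le_bigcup_finite infA finF) [W FFW AW].
have AWg : A `&` W #<= g @` (A `&` W).
  have /card_eqPle[_ //] : g @` (A `&` W) #= A `&` W.
  apply: inj_card_eq.
  by apply: sub_in2 gI => x /set_mem[Ax _]; exact/mem_set.
(* [W] itself competes in the choice of [g x] for [x] in [W], so [g x] cannot come after [W]. *)
have gW : g @` (A `&` W) `<=` [set W] `|` [set U | SS U /\ lt U W].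
  move=> _ [x [_ Wx] <-]; have [Sgx _ /(_ W (FS _ FFW) Wx)] := gP x.
  by move=> [->|]; [left|right].
have : A #<= [set W] `|` [set U | SS U /\ lt U W].
  exact: (card_le_trans AW (card_le_trans AWg (subset_card_le gW))).
move=> /(card_le_setU_infinite infA) [A1|AltW].
  by apply: infA; exact: card_le_finite A1 (finite_set1 _).
(* Closing [range g] under [s] gives a member of [P] no larger than [range g], hence dominated by
   the segment below [W], against minimality. *)
pose SS' := [set iter z.2 s z.1 | z in range g `*` [set: nat]].
have SS'S : SS' `<=` SS.
  move=> _ [[_ n] /= [[x _ <-] _] <-]; elim: n => [|n]; first by have [] := gP x.
  by move=> /Ss.
apply: (ltS W SS'); first exact: FS.
  split; first exact: (subset_trans SS'S).
    move=> x _; exists (g x); last by have [] := gP x.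
    by exists (g x, 0%N).
  by move=> _ [[U n] [/= gU _] <-]; exists (U, n.+1).
apply: card_le_trans AltW; apply: card_le_trans GA.
apply: card_le_trans (infinite_card_setX_nat infG); exact: card_image_le.
Qed.

Theorem theorem7p4 (X : topologicalType) (regX : regular_hausdorff X) :
  R_closed X <->
  (forall A : set X, infinite_set A ->
     theta_omega_converges A [set x : X | theta_omega_accumulation A x]).
Proof.
split=> [RX A infA|conv]; first exact: R_closed_theta_omega_converges.
apply/(R_closed_finitely_covering regX) => UU.
exact: theta_omega_converges_finitely_covering.
Qed.
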